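(* Let $G$ be an abelian group. Then the following conditions are equivalent: (a) every quotient of $G$ is residually finite; (b) every subgroup of $G$ is $\gamma_G$-closed; (c) every subgroup of $G$ is $\nu_G$-closed; (d) $G$ is strongly non-divisible; (e) $n=r_0(G)$ is finite and for every subgroup $F\cong\mathbb Z^n$ of $G$ one has $G/F\cong\bigoplus_p B_p$, where $p$ ranges over the primes and each $B_p$ is a bounded abelian $p$-group; (f) $n=r_0(G)$ is finite and for every subgroup $F$ of $G$ with $r_0(F)=n$ one has $G/F\cong\bigoplus_p B_p$, where $p$ ranges over the primes and each $B_p$ is a bounded abelian $p$-group; (g) $\mathcal C(G)\setminus\{G\}$ is cofinal in the poset of all proper subgroups of $G$ ordered by inclusion, i.e. every proper subgroup of $G$ is contained in some proper finite-index subgroup of $G$.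
   Context: An abelian group is residually finite if it is isomorphic to a subgroup of a direct product of finite abelian groups. The profinite topology $\gamma_G$ is the group topology on $G$ having all finite-index subgroups as a base of neighborhoods of $0$; the natural topology $\nu_G$ is the group topology on $G$ having $\{mG:m\in\mathbb N_+\}$ as a base of neighborhoods of $0$, where $\mathbb N_+$ is the set of positive integers and $mG=\{mx:x\in G\}$. These topologies need not be Hausdorff. An abelian group $G$ is strongly non-divisible if no quotient $G/H$ with $H$ a proper subgroup of $G$ is divisible (equivalently, every quotient of $G$ is reduced, i.e. has no non-zero divisible subgroup). $r_0(G)$ denotes the torsion-free rank of $G$. An abelian group $B$ is bounded if $mB=0$ for some $m\in\mathbb N_+$. $\mathcal C(G)$ is the family of all finite-index subgroups of $G$. *)

(* Defs.v *)
From HB Require Import structures.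
From mathcomp Require Import all_boot all_order all_algebra.
From mathcomp Require Import all_classical all_reals topology tvs.

Set Implicit Arguments.
Unset Strict Implicit.
Unset Printing Implicit Defensive.

Import GRing.Theory.

Local Open Scope classical_set_scope.
Local Open Scope ring_scope.

(* Abelian groups are [zmodType]s, subgroups of [G] are terms of
   [zmodClosed G], and the quotient of [G] by [H] is [Quotient.quot H].
   A [zmodClosed G] is a boolean predicate; under the classical axioms of
   mathcomp.classical.boolp this covers every subgroup of [G]. *)

(* MathComp defines this notation in a module that it does not export. *)
Notation "{ 'quot' H }" := (Quotient.quot H) : type_scope.

Definition subgroup_type (G : zmodType) (H : zmodClosed G) : Type :=
  {x : G | x \in H}.

Section SubgroupType.
Variables (G : zmodType) (H : zmodClosed G).
HB.instance Definition _ := SubChoice.on (subgroup_type H).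
HB.instance Definition _ := [SubChoice_isSubZmodule of subgroup_type H by <:].
End SubgroupType.

Definition isomorphic (A B : zmodType) : Prop :=
  exists f : {additive A -> B}, bijective f.

(* The alias is needed because MathComp only equips non-dependent functions
   with pointwise operations. *)
Definition direct_product (I : Type) (M : I -> zmodType) : Type :=
  forall i, M i.

Section DirectProduct.
Variables (I : Type) (M : I -> zmodType).
Local Notation P := (direct_product M).

HB.instance Definition _ := gen_eqMixin P.
HB.instance Definition _ := gen_choiceMixin P.

Let zero : P := fun=> 0.
Let opp (f : P) : P := fun i => - f i.
Let add (f g : P) : P := fun i => f i + g i.

Let addA : associative add.
Proof. by move=> f g h; apply: functional_extensionality_dep => i; apply: addrA. Qed.
Let addC : commutative add.
Proof. by move=> f g; apply: functional_extensionality_dep => i; apply: addrC. Qed.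
Let add0 : left_id zero add.
Proof. by move=> f; apply: functional_extensionality_dep => i; apply: add0r. Qed.
Let addN : left_inverse zero opp add.
Proof. by move=> f; apply: functional_extensionality_dep => i; apply: addNr. Qed.

HB.instance Definition _ := GRing.isZmodule.Build P addA addC add0 addN.

Definition finite_support : {pred P} :=
  fun f => `[< finite_set [set i | f i != 0] >].

Let finite_support_zmod_closed : zmod_closed finite_support.
Proof.
split=> [|f g /asboolP ffin /asboolP gfin]; apply/asboolP.
  by apply: (sub_finite_set _ (finite_set0 I)) => i /=; rewrite eqxx.
apply: (@sub_finite_set _ _ ([set i | f i != 0] `|` [set i | g i != 0])).
  move=> i /=; have [fi0|] := eqVneq (f i) 0; last by left.
  have [gi0|] := eqVneq (g i) 0; last by right.
  by rewrite [(f - g) i](_ : _ = f i - g i) // fi0 gi0 subrr eqxx.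
by rewrite finite_setU.
Qed.

HB.instance Definition _ :=
  GRing.isZmodClosed.Build P finite_support finite_support_zmod_closed.

Definition direct_sum : Type := subgroup_type finite_support.
HB.instance Definition _ := GRing.Zmodule.on direct_sum.

End DirectProduct.

Definition residually_finite (A : zmodType) : Prop :=
  exists (I : Type) (F : I -> finZmodType) (S : zmodClosed (direct_product F)),
    isomorphic A (subgroup_type S).

Definition finite_index (G : zmodType) (H : zmodClosed G) : Prop :=
  finite_set [set: {quot H}].

Definition proper_subgroup (G : zmodType) (H : zmodClosed G) : Prop :=
  [set` H] `<` [set: G].

Definition divisible (A : zmodType) : Prop :=
  forall (m : nat) (x : A), (0 < m)%N -> exists y : A, y *+ m = x.

Definition strongly_non_divisible (G : zmodType) : Prop :=
  forall H : zmodClosed G, proper_subgroup H -> ~ divisible {quot H}.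

Definition independent (G : zmodType) (n : nat) (t : n.-tuple G) : Prop :=
  forall c : 'I_n -> int,
    \sum_(i < n) tnth t i *~ c i = 0 -> forall i, c i = 0.

(* [has_r0 G n] means r_0(G) = n: [G] has a maximal independent subset of
   cardinality [n]. Coefficients are required to vanish, not just the terms
   [tnth t i *~ c i], so that only elements of infinite order are counted. *)
Definition has_r0 (G : zmodType) (n : nat) : Prop :=
  exists t : n.-tuple G,
    independent t /\ forall x : G, ~ independent [tuple of x :: t].

Definition bounded (A : zmodType) : Prop :=
  exists2 m : nat, (0 < m)%N & forall x : A, x *+ m = 0.

Definition abelian_pgroup (p : nat) (A : zmodType) : Prop :=
  forall x : A, exists k : nat, x *+ (p ^ k) = 0.

Definition sum_of_bounded_pgroups (A : zmodType) : Prop :=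
  exists B : {p : nat | prime p} -> zmodType,
    (forall p, abelian_pgroup (val p) (B p) /\ bounded (B p)) /\
    isomorphic A (direct_sum B).

(* A group topology on [G] having the members of a given downward directed
   family of subgroups as a base of neighborhoods of 0. *)
Record subgroup_base (G : zmodType) := SubgroupBase {
  base_subgroups : set (zmodClosed G);
  base_nonempty : base_subgroups !=set0;
  base_directed : forall H K, base_subgroups H -> base_subgroups K ->
    exists2 L, base_subgroups L & [set` L] `<=` [set` H] `&` [set` K]
}.

Definition linear_topology (G : zmodType) (B : subgroup_base G) : Type := G.

Section LinearTopology.
Variables (G : zmodType) (B : subgroup_base G).
Local Notation T := (linear_topology B).

HB.instance Definition _ := GRing.Zmodule.on T.

Definition linear_nbhs (x : T) : set_system T :=
  [set A | exists2 H : zmodClosed G, base_subgroups B H & forall h : G, h \in H -> A (x + h)].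

HB.instance Definition _ := hasNbhs.Build T linear_nbhs.

Let linear_nbhs_filter (x : T) : ProperFilter (nbhs x).
Proof.
apply: Build_ProperFilter_ex.
  by move=> A [H _ HA]; exists (x + 0); apply: HA; apply: rpred0.
split.
- by have [H BH] := base_nonempty B; exists H.
- move=> A A' [H BH HA] [K BK KA].
  have [L BL LHK] := base_directed BH BK; exists L => // h hL.
  by have [hH hK] := LHK h hL; split; [apply: HA | apply: KA].
- by move=> A A' AA' [H BH HA]; exists H => // h hH; apply/AA'/HA.
Qed.

Let linear_nbhs_singleton (x : T) (A : set T) : nbhs x A -> A x.
Proof. by case=> H _ /(_ 0 (rpred0 H)); rewrite addr0. Qed.

Let linear_nbhs_nbhs (x : T) (A : set T) : nbhs x A -> nbhs x (nbhs^~ A).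
Proof.
case=> H BH HA; exists H => // h hH; exists H => // k kH.
by rewrite -addrA; apply: HA; apply: rpredD.
Qed.

HB.instance Definition _ := Nbhs_isNbhsTopological.Build T
  linear_nbhs_filter linear_nbhs_singleton linear_nbhs_nbhs.

Let linear_sub_continuous : continuous (fun x : T * T => x.1 - x.2).
Proof.
move=> [x y] A [H BH HA].
exists ([set z | z - x \in H], [set z | z - y \in H]) => /=.
  by split; exists H => // h hH /=; rewrite addrC addKr.
move=> [u v] /= [uH vH].
have -> : u - v = (x - y) + ((u - x) - (v - y)).
  by rewrite addrACA subrKC -opprD subrKC.
by apply: HA; apply: rpredB.
Qed.

HB.instance Definition _ :=
  PreTopologicalNmodule_isTopologicalZmodule.Build T linear_sub_continuous.

End LinearTopology.

Section Profinite.
Variable G : zmodType.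

Let trivial_closed : zmod_closed (predT : {pred G}).
Proof. by []. Qed.

HB.instance Definition _ :=
  GRing.isZmodClosed.Build G (predT : {pred G}) trivial_closed.

Let finite_index_nonempty : [set H : zmodClosed G | finite_index H] !=set0.
Proof.
exists (predT : zmodClosed G); apply: (@sub_finite_set _ _ [set 0]) => //.
move=> x _ /=; rewrite -[x]reprK -[RHS]reprK.
by apply/eqP; rewrite -Quotient.idealrBE.
Qed.

Section Inter.
Variables H K : zmodClosed G.

Definition inter_pred : {pred G} := [pred x | (x \in H) && (x \in K)].

Let inter_zmod_closed : zmod_closed inter_pred.
Proof.
split=> [|x y /andP[xH xK] /andP[yH yK]]; rewrite !inE ?rpred0 //.
by rewrite !rpredB.
Qed.

HB.instance Definition _ :=
  GRing.isZmodClosed.Build G inter_pred inter_zmod_closed.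

End Inter.

Let finite_index_directed (H K : zmodClosed G) :
  [set H : zmodClosed G | finite_index H] H ->
  [set H : zmodClosed G | finite_index H] K ->
  exists2 L : zmodClosed G, [set H : zmodClosed G | finite_index H] L &
    [set` L] `<=` [set` H] `&` [set` K].
Proof.
move=> Hfin Kfin; exists (inter_pred H K : zmodClosed G); last first.
  by move=> x /andP[].
pose f (x : {quot (inter_pred H K : zmodClosed G)}) : {quot H} * {quot K} :=
  (\pi_({quot H})%qT (repr x), \pi_({quot K})%qT (repr x)).
have f_inj : injective f.
  move=> x y [/eqP + /eqP +]; rewrite -!Quotient.idealrBE => xyH xyK.
  rewrite -[x]reprK -[y]reprK; apply/eqP.
  by rewrite -Quotient.idealrBE inE xyH.
rewrite /= /finite_index -(preimage_setT f).
apply: finite_preimage; first by move=> x y _ _; apply: f_inj.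
by rewrite -setXTT; apply: finite_setX.
Qed.

Definition finite_index_base : subgroup_base G :=
  SubgroupBase finite_index_nonempty finite_index_directed.

Definition profinite_topology : topologicalZmodType :=
  linear_topology finite_index_base.

Definition profinite_closed (A : set G) : Prop :=
  closed (A : set profinite_topology).

End Profinite.

Section Natural.
Variable G : zmodType.

Definition multiples (m : nat) : {pred G} :=
  fun x => `[< exists y : G, x = y *+ m >].

Let multiples_zmod_closed m : zmod_closed (multiples m).
Proof.
split=> [|_ _ /asboolP[x ->] /asboolP[y ->]]; apply/asboolP.
  by exists 0; rewrite mul0rn.
by exists (x - y); rewrite mulrnBl.
Qed.

HB.instance Definition _ m :=
  GRing.isZmodClosed.Build G (multiples m) (multiples_zmod_closed m).

Definition multiples_family : set (zmodClosed G) :=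
  [set H | exists2 m : nat, (0 < m)%N & H = (multiples m : zmodClosed G)].

Let multiples_nonempty : multiples_family !=set0.
Proof. by exists (multiples 1 : zmodClosed G); exists 1%N. Qed.

Let multiples_directed (H K : zmodClosed G) :
  multiples_family H -> multiples_family K ->
  exists2 L : zmodClosed G, multiples_family L &
    [set` L] `<=` [set` H] `&` [set` K].
Proof.
move=> [m m_gt0 ->] [n n_gt0 ->].
exists (multiples (m * n) : zmodClosed G).
  by exists (m * n)%N; rewrite // muln_gt0 m_gt0.
move=> _ /asboolP[x ->]; split; apply/asboolP.
  by exists (x *+ n); rewrite -mulrnA mulnC.
by exists (x *+ m); rewrite -mulrnA.
Qed.

Definition multiples_base : subgroup_base G :=
  SubgroupBase multiples_nonempty multiples_directed.

Definition natural_topology : topologicalZmodType :=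
  linear_topology multiples_base.

Definition natural_closed (A : set G) : Prop :=
  closed (A : set natural_topology).

End Natural.

(* Main.v *)
(* All conditions are compared with two intermediate ones: that every subgroup of
   [G] is an intersection of subgroups of finite index (separation), and that no
   [F/K] with [K < F <= G] is divisible (hereditary reducedness).

   Separation follows from (d): a subgroup [M] maximal among those avoiding [x]
   has a cocyclic quotient, and a cocyclic group is finite or divisible. It gives
   (a) and (g), and hereditary reducedness, because finite groups have no nonzero
   divisible sections.

   Hereditary reducedness gives (e). An infinite independent sequence would span a
   subgroup that maps onto a nonzero divisible subgroup of Q/Z, so the rank is
   finite. An unbounded p-component contains a nonzero divisible subgroup if the
   finite heights of its socle elements are bounded, and otherwise independent
   elements [x_i] of unbounded order, whose span maps onto Z(p^oo).

   From (f) back to (d): let [G/H] be divisible and [F] free of rank [r_0(G)].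
   Since the primary components of [G/F] are bounded, [G = F + H], so [G/H] is
   finitely generated and equal to its double; a determinant of the form
   [det (1 - 2 M)], which is odd, then annihilates it, whence [G = H]. *)

Require Import Defs.
From HB Require Import structures.
From mathcomp Require Import all_boot all_order all_algebra.
From mathcomp Require Import all_classical all_reals topology tvs.

Set Implicit Arguments.
Unset Strict Implicit.
Unset Printing Implicit Defensive.

Import Order.TTheory GRing.Theory Num.Theory.

Local Open Scope classical_set_scope.
Local Open Scope ring_scope.

(** * Subgroups given by predicates, and arguments one prime at a time *)

Lemma subrACA (A : zmodType) (x y z t : A) :
  x - y - (z - t) = x - z - (y - t).
Proof. by rewrite !opprB addrACA [RHS]addrACA [- y - z]addrC. Qed.

(** Classical reflection makes the predicate boolean; stating existence hides the packed structure
    and leaves only its membership rule. *)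
Lemma subgroup_of (A : zmodType) (S : set A) :
  S 0 -> (forall x y, S x -> S y -> S (x - y)) ->
  exists H : zmodClosed A, forall x, x \in H <-> S x.
Proof.
move=> S0 SB; pose P : {pred A} := fun x => `[< S x >].
have Pclosed : zmod_closed P.
  by split=> [|x y /asboolP Sx /asboolP Sy]; apply/asboolP => //; apply: SB.
pose H : zmodClosed A := HB.pack P (GRing.isZmodClosed.Build A P Pclosed).
by exists H => x; split=> /asboolP.
Qed.

Lemma subgroup0 (A : zmodType) :
  exists H : zmodClosed A, forall x, x \in H <-> x = 0.
Proof. by apply: (@subgroup_of A [set 0]) => // x y -> ->; rewrite /= subr0. Qed.

Lemma rpred_coprime (A : zmodType) (H : zmodClosed A) (x : A) (m n : nat) :
  coprime m n -> x *+ m \in H -> x *+ n \in H -> x \in H.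
Proof.
move=> /eqP mn xm xn; have [u [v uv]] := Bezoutz m n.
have -> : x = (x *+ m) *~ u + (x *+ n) *~ v.
  rewrite !pmulrn -!mulrzA -mulrzDr mulrC (mulrC n%:Z) uv.
  by rewrite /gcdz !absz_nat mn mulr1z.
by rewrite rpredD ?rpredMz.
Qed.

Lemma eq0_coprime (A : zmodType) (x : A) (m n : nat) :
  coprime m n -> x *+ m = 0 -> x *+ n = 0 -> x = 0.
Proof.
move=> mn xm xn; have [H HP] := subgroup0 A.
by apply/HP/(rpred_coprime mn); apply/HP.
Qed.

(* The least positive [n] with [n x] in [H] divides every such [n], so that no
   prime can divide it. *)
Lemma rpred_local (A : zmodType) (H : zmodClosed A) (x : A) :
  (forall p, prime p -> exists2 m, coprime p m & x *+ m \in H) -> x \in H.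
Proof.
move=> loc.
have exn : exists n, (0 < n)%N && (x *+ n \in H).
  have [[//|m] _ xm] := loc 2 isT.
  by exists m.+1.
case: (ex_minnP exn) => n /andP[n_gt0 xn] n_min.
have [n1|n_neq1] := eqVneq n 1%N; first by rewrite n1 in xn.
have n_gt1 : (1 < n)%N by rewrite ltn_neqAle eq_sym n_neq1.
have [m pm xm] := loc _ (pdiv_prime n_gt1).
have [km kn e _] := egcdnP m n_gt0.
have xg : x *+ gcdn n m \in H.
  have -> : x *+ gcdn n m = x *+ n *+ km - x *+ m *+ kn.
    by rewrite -!mulrnA (mulnC n) e mulrnDr (mulnC m) addrC addKr.
  by apply: rpredB; apply: rpredMn.
have le : (n <= gcdn n m)%N by apply: n_min; rewrite gcdn_gt0 n_gt0.
have nm : (n %| m)%N.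
  have /eqP <- : gcdn n m == n; last exact: dvdn_gcdr.
  by rewrite eqn_leq le andbT; apply: dvdn_leq => //; apply: dvdn_gcdl.
move: pm; rewrite prime_coprime ?pdiv_prime //.
by rewrite (dvdn_trans (pdiv_dvd n) nm).
Qed.

Lemma eq0_local (A : zmodType) (x : A) :
  (forall p, prime p -> exists2 m, coprime p m & x *+ m = 0) -> x = 0.
Proof.
move=> loc; have [H HP] := subgroup0 A.
by apply/HP/rpred_local => p /loc[m pm xm]; exists m => //; apply/HP.
Qed.

Lemma rpred_absz (A : zmodType) (H : zmodClosed A) (x : A) (j : int) :
  x *~ j \in H -> x *+ `|j|%N \in H.
Proof. by rewrite pmulrn abszE; case: ger0P => _ //; rewrite mulrNz rpredN. Qed.

Lemma mulrn_absz_eq0 (A : zmodType) (x : A) (j : int) :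
  x *~ j = 0 -> x *+ `|j|%N = 0.
Proof. by rewrite pmulrn abszE; case: ger0P => _ //; rewrite mulrNz => ->; rewrite oppr0. Qed.

Lemma eq0_coprimez (A : zmodType) (x : A) (p : nat) (j : int) :
  prime p -> ~~ (p %| j)%Z -> x *+ p = 0 -> x *~ j = 0 -> x = 0.
Proof.
move=> pp pj xp xj; apply: (@eq0_coprime A x p `|j|%N) => //.
  by rewrite prime_coprime // -[p]absz_nat -dvdzE.
exact: mulrn_absz_eq0.
Qed.

(** * Quotients and finite index *)

Section Quotient.
Variables (G : zmodType) (H : zmodClosed G).
Local Notation pi := (\pi_({quot H})%qT : G -> {quot H}).

Lemma pi_eq0 (x : G) : (pi x == 0) = (x \in H).
Proof. by rewrite -[0](raddf0 pi) -Quotient.idealrBE subr0. Qed.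

Lemma pi_eq0P (x : G) : pi x = 0 <-> x \in H.
Proof. by rewrite -pi_eq0; split=> [->|/eqP]. Qed.

Lemma divisible_quotP :
  divisible {quot H} <->
  forall m x, (0 < m)%N -> exists y, y *+ m - x \in H.
Proof.
split=> [div m x /(div m (pi x))[y]|div m x m_gt0].
  rewrite -[y]reprK -raddfMn /= => e; exists (repr y).
  by rewrite -pi_eq0 raddfB /= e subrr.
have [y] := div m (repr x) m_gt0; rewrite -pi_eq0 raddfB /= raddfMn subr_eq0.
by rewrite reprK => /eqP; exists (pi y).
Qed.

(** The multiples of a class cannot all differ in a finite quotient, so each class has finite order;
    the product of these orders over a list of the quotient serves for all. *)
Lemma finite_index_multiples :
  finite_index H -> exists2 m, (0 < m)%N & forall x, x *+ m \in H.
Proof.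
move=> /finite_seqP[s sE].
have tor (q : {quot H}) : exists2 m, (0 < m)%N & q *+ m = 0.
  apply: contrapT => ntor; apply: infinite_nat.
  rewrite -(preimage_setT (fun n => q *+ n)); apply: finite_preimage; last first.
    by apply/finite_seqP; exists s.
  move=> i j _ _; wlog ij : i j / (i <= j)%N => [wl|] /= qij.
    by have [/wl|/ltnW/wl] := leqP i j; [apply|move=> e; apply/esym/e].
  apply/eqP; rewrite eqn_leq ij leqNgt; apply/negP => lt_ij; apply: ntor.
  by exists (j - i)%N; rewrite ?subn_gt0 // mulrnBr // qij subrr.
have [m m_gt0 ms] : exists2 m, (0 < m)%N & forall q, q \in s -> q *+ m = 0.
  elim: (s) => [|q r [m m_gt0 mr]]; first by exists 1%N.
  have [n n_gt0 qn] := tor q; exists (n * m)%N; first by rewrite muln_gt0 n_gt0.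
  move=> q'; rewrite inE => /predU1P[->|/mr q'm]; first by rewrite mulrnA qn mul0rn.
  by rewrite mulnC mulrnA q'm mul0rn.
exists m => // x; rewrite -pi_eq0 raddfMn ms //.
by have : [set: {quot H}] (pi x) by []; rewrite sE.
Qed.
End Quotient.

(** * Maximal avoiding subgroups and cocyclic quotients *)

Definition residually_separated (G : zmodType) : Prop :=
  forall (H : zmodClosed G) (x : G), x \notin H ->
    exists M : zmodClosed G, [/\ finite_index M, {subset H <= M} & x \notin M].

(** By maximality of [M], adjoining any [y] outside [M] captures [x], so the image of [x] lies in
    every nonzero cyclic subgroup of the quotient by [M]. *)
Lemma exists_maximal_avoiding (A : zmodType) (K : zmodClosed A) (x : A) :
  x \notin K ->
  exists M : zmodClosed A, [/\ {subset K <= M}, x \notin M &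
    forall y, y \notin M -> exists j, x - y *~ j \in M].
Proof.
move=> xK.
(* The union with [K] makes the empty chain harmless. *)
pose sub (X : set A) := X `|` [set` K].
pose P (X : set A) :=
  [/\ forall y z, sub X y -> sub X z -> sub X (y - z) & ~ X x].
have [F PF totF|X [[XB Xx] Xmax]] := @Zorn_bigcup A P.
  split=> [y z|[X /PF[_ Xx] /Xx] //].
  move=> [[X FX Xy]|Ky] [[Y FY Yz]|Kz]; last by right; apply: rpredB.
  - have [Z [FZ Zy Zz]] : exists Z, [/\ F Z, Z y & Z z].
      by have [XY|YX] := totF _ _ FX FY; [exists Y|exists X]; split=> //;
         [apply: XY|apply: YX].
    have [+ _] := PF _ FZ => /(_ y z (or_introl Zy) (or_introl Zz)) [?|?].
      by left; exists Z.
    by right.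
  - have [+ _] := PF _ FX => /(_ y z (or_introl Xy) (or_intror Kz)) [?|?].
      by left; exists X.
    by right.
  - have [+ _] := PF _ FY => /(_ y z (or_intror Ky) (or_introl Yz)) [?|?].
      by left; exists Y.
    by right.
have [|M MP] := subgroup_of _ XB; first by right; apply: rpred0.
exists M; split=> [y Ky||y yM]; first by apply/MP; right.
  by apply/negP => /MP[//|/= xK']; rewrite xK' in xK.
apply: contrapT => nj.
have [|u v [j uj] [k vk]|M' M'P] :=
    @subgroup_of A [set z | exists j, z - y *~ j \in M].
- by exists 0; rewrite mulr0z subr0 rpred0.
- by exists (j - k); rewrite mulrzBr subrACA rpredB.
have MM' z : z \in M -> z \in M'.
  by move=> zM; apply/M'P; exists 0; rewrite mulr0z subr0.
have XE : sub [set` M'] = [set` M'].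
  apply/seteqP; split=> z; last by left.
  by case=> // Kz; apply/MM'/MP; right.
apply: (Xmax [set` M']); last first.
  by split; [rewrite XE => u v; apply: rpredB|move=> /M'P].
split; first by move=> z Xz; apply/MM'/MP; left.
move=> /(_ y); rewrite /= => h.
have : X y by apply: h; apply/M'P; exists 1; rewrite mulr1z subrr rpred0.
by move=> Xy; move/negP: yM; apply; apply/MP; left.
Qed.

Lemma coprime_divide (A : zmodType) (x : A) (m : nat) (j : int) :
  coprime m `|j| -> x *+ m = 0 -> exists u : int, x *~ u *~ j = x.
Proof.
move=> /eqP mj xm; have [u [v uv]] := Bezoutz m j; exists v.
rewrite -mulrzA; apply/eqP; rewrite -subr_eq0 -{2}[x]mulr1z -mulrzBr.
have -> : v * j - 1 = - (m%:Z * u).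
  have e : u * m + v * j = 1 by rewrite uv /gcdz mj.
  by rewrite -[X in _ - X]e opprD addrCA subrr addr0 mulrC.
by rewrite mulrNz mulrzA -pmulrn xm mul0rz oppr0.
Qed.

(** The socle elements in [p ^ N A] have infinite height; division by [p] follows by induction on
    the exponent of [a], and the part of [m] prime to [p] is inverted by a Bezout coefficient. *)
Lemma divide_of_infinite_height (A : zmodType) (p N : nat) :
  prime p ->
  (forall z n, z *+ p = 0 -> (exists y : A, z = y *+ p ^ N) ->
     exists y, z = y *+ p ^ n) ->
  forall m (a : A) k, (0 < m)%N -> a *+ p ^ k = 0 ->
  (exists y, a = y *+ p ^ N) ->
  exists b : A, [/\ b *+ m = a, exists j, b *+ p ^ j = 0 & exists y, b = y *+ p ^ N].
Proof.
move=> p_pr socle.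
have divp k : forall a : A, a *+ p ^ k = 0 -> (exists y, a = y *+ p ^ N) ->
    exists c, a = c *+ p ^ N *+ p.
  elim: k => [|k IH] a; first by rewrite mulr1n => -> _; exists 0; rewrite !mul0rn.
  move=> ak [y ay].
  (* Subtracting [z *+ p ^ N.+1] lowers the exponent of [a] by one and stays inside [p ^ N A]. *)
  have [||z az] := socle (a *+ p ^ k) (N.+1 + k)%N.
  - by rewrite -mulrnA -expnSr.
  - by exists (y *+ p ^ k); rewrite ay -!mulrnA mulnC.
  have [||c ac] := IH (a - z *+ p ^ N.+1).
  - by rewrite mulrnBl -mulrnA -expnD -az subrr.
  - by exists (y - z *+ p); rewrite mulrnBl ay -mulrnA -expnS.
  exists (c + z); rewrite !mulrnDl -ac -mulrnA -expnSr.
  by rewrite subrK.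
move=> m a k m_gt0 ak aN.
have [n pn ->] := pfactor_coprime p_pr m_gt0.
elim: (logn p m) => [|l [b [bl [j bj] [y bN]]]].
  have [|u au] := @coprime_divide A a (p ^ k) n _ ak; rewrite ?pmulrn.
    exact: coprimeXl.
  have [y ay] := aN; exists (a *~ u); rewrite muln1; split=> //.
    by exists k; rewrite pmulrn mulrzAC -pmulrn ak mul0rz.
  by exists (y *~ u); rewrite ay !pmulrn mulrzAC.
have [|c bc] := divp j b bj; first by exists y.
exists (c *+ p ^ N); split; last by exists c.
  by rewrite expnS mulnCA mulrnA -bc.
by exists j.+1; rewrite expnS mulrnA -bc.
Qed.

(** Multiplication by [p] sends [p ^ k.+1]-torsion to [p ^ k]-torsion, with fibres that are
    translates of the [p]-torsion; [r] picks a point in each fibre. *)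
Lemma finite_torsion (A : zmodType) (p k : nat) :
  finite_set [set z : A | z *+ p = 0] -> finite_set [set z : A | z *+ p ^ k = 0].
Proof.
move=> fin1; elim: k => [|k fink].
  by apply: (sub_finite_set _ (finite_set1 (0 : A))) => z; rewrite /= mulr1n.
have [r rP] : exists r : A -> A, forall z, r (z *+ p) *+ p = z *+ p.
  exists (fun w => xget 0 [set z | z *+ p = w]) => z.
  by case: xgetP => [y _ //|/(_ z)]; case.
apply: (sub_finite_set _ (finite_image (fun u => r u.1 + u.2)
                            (finite_setX fink fin1))) => z /= zk.
exists (z *+ p, z - r (z *+ p)) => /=; last by rewrite addrC subrK.
by rewrite -mulrnA -expnS mulrnBl rP subrr.
Qed.

(** The element [x] has prime order [p] and generates the socle of the [p]-group [A]. If [x] has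
    infinite height, [A] is divisible; if [x] is not in [p ^ n A], then [p ^ n A] is zero, and [A]
    is finite because its socle is. *)
Lemma finite_or_divisible_of_cocyclic (A : zmodType) (x : A) :
  x != 0 -> (forall y, y != 0 -> exists j : int, x = y *~ j) ->
  finite_set [set: A] \/ divisible A.
Proof.
move=> x_neq0 x_mul.
have [p p_pr xp] : exists2 p, prime p & x *+ p = 0.
  apply: contrapT => nop; case/eqP: x_neq0; apply: eq0_local => p p_pr.
  have [xp|/x_mul[j xj]] := eqVneq (x *+ p) 0; first by case: nop; exists p.
  (* From [x = x *+ p *~ j], the integer [1 - p j] kills [x] and is prime to [p]. *)
  exists `|(1 - p%:Z * j)%R|%N.
    rewrite prime_coprime // -[p]absz_nat -dvdzE; apply/negP => pd.
    have := rpredD pd (dvdz_mulr j (dvdzz p)); rewrite subrK => pd1.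
    by move: pd1 p_pr; rewrite dvdzE dvdn1 => /eqP /= ->.
  have e : x *~ (1 - p%:Z * j) = 0.
    by rewrite mulrzBr mulr1z mulrzA -pmulrn -xj subrr.
  exact: mulrn_absz_eq0.
have xcop (j : int) : x *~ j = 0 -> (p %| j)%Z.
  move=> xj; apply: contraT => pj; case/eqP: x_neq0.
  exact: eq0_coprimez pj xp xj.
have ptor (y : A) : exists k, y *+ p ^ k = 0.
  have [->|y0] := eqVneq y 0; first by exists 0%N.
  have [j xj] := x_mul _ y0.
  have j_gt0 : (0 < `|j|)%N.
    by rewrite absz_gt0; apply: contraNneq x_neq0 => j0; rewrite xj j0 mulr0z.
  have m_gt0 : (0 < p * `|j|)%N by rewrite muln_gt0 prime_gt0.
  have [n pn mE] := pfactor_coprime p_pr m_gt0.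
  (* Otherwise this multiple of [y] is nonzero and killed by [n]; it has [x] as a multiple, so [n]
     would kill [x], which has order [p]. *)
  exists (logn p (p * `|j|)); apply: contrapT => /eqP z0.
  have [i xi] := x_mul _ z0; case/eqP: x_neq0.
  apply: (eq0_coprime pn xp).
  have ym : y *+ (p * `|j|) = 0.
    by rewrite mulrnA; apply: mulrn_absz_eq0; rewrite pmulrn mulrzAC -xj.
  by rewrite xi pmulrn mulrzAC -pmulrn -mulrnA mulnC -mE ym mul0rz.
have soc (y : A) : y *+ p = 0 -> exists i : int, y = x *~ i.
  have [->|y0] := eqVneq y 0; first by exists 0; rewrite mulr0z.
  move=> yp; have [i xi] := x_mul _ y0.
  have pi : coprime p `|i|.
    rewrite prime_coprime // -[p]absz_nat -dvdzE; apply: contra x_neq0.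
    by case/dvdzP=> c ic; rewrite xi ic mulrC mulrzA -pmulrn yp mul0rz.
  have [u yu] := coprime_divide pi yp.
  by exists u; rewrite xi mulrzAC yu.
have [ht|nht] := pselect (forall n, exists y, x = y *+ p ^ n).
  right=> m a m_gt0; have [k ak] := ptor a.
  have [||b [bm _ _]] := @divide_of_infinite_height A p 0 p_pr _ m a k m_gt0 ak.
  - move=> z n /soc[i ->] _; have [y ->] := ht n.
    by exists (y *~ i); rewrite !pmulrn mulrzAC.
  - by exists a.
  by exists b.
left; have /existsNP[n xn] := nht.
apply: (sub_finite_set (B := [set z : A | z *+ p ^ n = 0])).
  move=> z _ /=; apply: contrapT => /eqP /x_mul[j xj]; apply: xn.
  by exists (z *~ j); rewrite xj !pmulrn mulrzAC.
apply: finite_torsion.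
apply: (sub_finite_set _ (finite_image (fun i => x *+ i) (finite_II p))).
have p_gt0 := prime_gt0 p_pr; have p_neq0 : p%:Z != 0 by rewrite eqz_nat -lt0n.
move=> z /soc[i ->] /=; exists `|(i %% p)%Z|%N.
  by rewrite /= -ltz_nat gez0_abs ?modz_ge0 ?ltz_pmod.
rewrite pmulrn gez0_abs ?modz_ge0 //.
rewrite [in RHS](divz_eq i p) [RHS]mulrzDr [X in _ = _ *~ X + _]mulrC mulrzA.
by rewrite -pmulrn xp mul0rz add0r.
Qed.

Lemma residually_separated_of_strongly_non_divisible (G : zmodType) :
  strongly_non_divisible G -> residually_separated G.
Proof.
move=> snd H x xH; have [M [HM xM Mmax]] := exists_maximal_avoiding xH.
have pix : \pi_({quot M})%qT x != 0 by rewrite pi_eq0.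
have [q q0||div] := finite_or_divisible_of_cocyclic pix; last 1 first.
- case: (snd M) => //; split=> [//|] /(_ x I) /=.
  by move=> xM'; rewrite xM' in xM.
- have [|j xj] := Mmax (repr q); first by rewrite -pi_eq0 reprK.
  exists j; apply/eqP; rewrite -[q]reprK -raddfMz -subr_eq0 -raddfB /=.
  by rewrite pi_eq0.
by exists M.
Qed.

(** * Reducedness of all sections *)

(** The premise says that [(F + K) / K] is divisible and the conclusion that it is zero, without
    forming a quotient of a subgroup. *)
Definition hereditarily_reduced (A : zmodType) : Prop :=
  forall F K : zmodClosed A,
    (forall m f, (0 < m)%N -> f \in F -> exists2 g, g \in F & g *+ m - f \in K) ->
    {subset F <= K}.

Lemma hereditarily_reduced_of_separated (G : zmodType) :
  residually_separated G -> hereditarily_reduced G.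
Proof.
move=> sep F K div x xF; apply: contraT => /sep[M [Mfin KM xM]].
have [m m_gt0 mM] := finite_index_multiples Mfin.
have [g _ /KM gM] := div m x m_gt0 xF.
by rewrite -(subKr (g *+ m) x) rpredB in xM.
Qed.

Lemma hereditarily_reduced_quot (G : zmodType) (H : zmodClosed G) :
  hereditarily_reduced G -> hereditarily_reduced {quot H}.
Proof.
move=> red F K div.
have preim (S : zmodClosed {quot H}) :
    exists S' : zmodClosed G, forall x, x \in S' <-> \pi_({quot H})%qT x \in S.
  apply: subgroup_of; first by rewrite raddf0 rpred0.
  by move=> x y xS yS; rewrite raddfB rpredB.
have [[F' F'P] [K' K'P]] := (preim F, preim K).
move=> q; rewrite -[q]reprK => /F'P qF; apply/K'P/(red F') => // m f m_gt0 /F'P.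
move=> /(div m _ m_gt0)[g gF gK]; exists (repr g); first by apply/F'P; rewrite reprK.
by apply/K'P; rewrite raddfB raddfMn /= reprK.
Qed.

(** * Maps to [Q/Z] given by weights *)

Lemma pair_mulrz (A B : zmodType) (x : A) (y : B) (n : int) :
  (x, y) *~ n = (x *~ n, y *~ n).
Proof. by rewrite [LHS]surjective_pairing (raddfMz fst) (raddfMz snd). Qed.

(* [L] is the graph of a homomorphism from a subgroup of [A] to [Q/Z] with
   divisible image. *)
Lemma int_of_divisible_graph (A : zmodType) (L : zmodClosed (A * rat)%type) :
  hereditarily_reduced A ->
  (forall q, (0, q) \in L -> q \is a Num.int) ->
  (forall m z q, (0 < m)%N -> (z, q) \in L ->
     exists z' q', (z', q') \in L /\ q' *+ m - q \is a Num.int) ->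
  forall z q, (z, q) \in L -> q \is a Num.int.
Proof.
move=> red fct div.
(* [F] is the domain of the map and [K] its kernel; the divisible section [F / K] must vanish. *)
have [|x y [q xq] [r yr]|F FP] := @subgroup_of A [set z | exists q, (z, q) \in L].
- by exists 0; apply: rpred0.
- by exists (q - r); rewrite -[(_, _)]/((x, q) - (y, r)) rpredB.
have [|x y [q xq qi] [r yr ri]|K KP] :=
    @subgroup_of A [set z | exists2 q, (z, q) \in L & q \is a Num.int].
- by exists 0; [apply: rpred0 | apply: rpred0].
- by exists (q - r); rewrite ?rpredB // -[(_, _)]/((x, q) - (y, r)) rpredB.
have FK : {subset F <= K}.
  apply: red => m f m_gt0 /FP[q fq]; have [z [r [zr rm]]] := div _ _ _ m_gt0 fq.
  exists z; first by apply/FP; exists r.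
  apply/KP; exists (r *+ m - q) => //.
  have -> : (z *+ m - f, r *+ m - q) = (z, r) *+ m - (f, q).
    by rewrite [z *+ m]pmulrn [r *+ m]pmulrn [_ *+ m]pmulrn pair_mulrz.
  by rewrite rpredB ?rpredMn.
move=> z q zq; have /FK/KP[r zr ri] : z \in F by apply/FP; exists q.
rewrite -(subrK r q) rpredD // fct //.
by rewrite -[0](subrr z) -[(_, _)]/((z, q) - (z, r)) rpredB.
Qed.

Lemma seq_span (V : zmodType) (v : nat -> V) :
  exists S : zmodClosed V, forall z,
    z \in S <-> exists N (c : nat -> int), z = \sum_(i < N) v i *~ c i.
Proof.
apply: subgroup_of; first by exists 0%N, (fun=> 0); rewrite big_ord0.
move=> _ _ [N [c ->]] [M [d ->]].
pose ext n (e : nat -> int) i := if (i < n)%N then e i else 0.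
have extE n (e : nat -> int) k : (n <= k)%N ->
    \sum_(i < n) v i *~ e i = \sum_(i < k) v i *~ ext n e i.
  move=> nk; rewrite (big_ord_widen k (fun i => v i *~ e i)) // big_mkcond /=.
  by apply: eq_bigr => i _; rewrite /ext; case: ifP; rewrite ?mulr0z.
exists (maxn N M), (fun i => ext N c i - ext M d i).
rewrite (extE N c (maxn N M)) ?leq_maxl // (extE M d (maxn N M)) ?leq_maxr //.
by rewrite -sumrB; apply: eq_bigr => i _; rewrite mulrzBr.
Qed.

Lemma seq_span_gen (V : zmodType) (v : nat -> V) i :
  exists N (c : nat -> int), v i = \sum_(k < N) v k *~ c k.
Proof.
exists i.+1, (fun k => (k == i)%:Z); rewrite big_ord_recr /= eqxx mulr1z big1 ?add0r //.
by move=> k _; rewrite ltn_eqF ?mulr0z.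
Qed.

(** Sending [x i] to the class of [w i] in [Q/Z] is well defined on the span of the [x i] by the
    second hypothesis and has divisible image by the third, so the image is zero. *)
Lemma int_of_weights (A : zmodType) (x : nat -> A) (w : nat -> rat) :
  hereditarily_reduced A ->
  (forall N (e : nat -> int), \sum_(i < N) x i *~ e i = 0 ->
     \sum_(i < N) w i *~ e i \is a Num.int) ->
  (forall m i, (0 < m)%N -> exists j (u : int),
     w j *~ u *+ m - w i \is a Num.int) ->
  forall i, w i \is a Num.int.
Proof.
move=> red indep div i.
have [L LP] := seq_span (fun i => (x i, w i)).
have sumE N (e : nat -> int) : \sum_(i < N) (x i, w i) *~ e i =
    (\sum_(i < N) x i *~ e i, \sum_(i < N) w i *~ e i).
  elim: N => [|N IH]; first by rewrite !big_ord0.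
  rewrite !big_ord_recr /= IH -[RHS]/((_, _) + (x N *~ e N, w N *~ e N)); congr (_ + _).
  by rewrite pair_mulrz.
have Lgen k : (x k, w k) \in L by apply/LP/(seq_span_gen (fun i => (x i, w i))).
apply: (int_of_divisible_graph red _ _ (Lgen i)).
  move=> q /LP[N [c]]; rewrite sumE => -[x0 ->]; exact: indep.
move=> m z q m_gt0 /LP[N [c]]; rewrite sumE => -[_ ->] {q}.
elim: N => [|N [y [q [yL qi]]]].
  by exists 0, 0; rewrite big_ord0 mul0rn subr0 !rpred0.
have [j [u ju]] := div m N m_gt0.
exists (y + x j *~ u *~ c N), (q + w j *~ u *~ c N); split.
  rewrite -[(_, _)]/((_, _) + (x j *~ u *~ c N, w j *~ u *~ c N)) rpredD //.
  have -> : (x j *~ u *~ c N, w j *~ u *~ c N) = (x j, w j) *~ u *~ c N.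
    by rewrite !pair_mulrz.
  by rewrite !rpredMz.
rewrite big_ord_recr /= mulrnDl opprD addrACA rpredD //.
have -> : w j *~ u *~ c N *+ m - w N *~ c N = (w j *~ u *+ m - w N) *~ c N.
  by rewrite mulrzBl; congr (_ - _); rewrite !pmulrn mulrzAC.
by rewrite rpredMz.
Qed.

(** * Boundedness of primary components *)

(** The [s i] have strictly increasing heights. At the least [i] with [f i] not divisible by [p],
    earlier terms vanish and later ones have height above [h i], so [s i] would too. *)
Lemma independent_socle (A : zmodType) (p : nat) (s : nat -> A) (h : nat -> nat) :
  prime p -> {homo h : i j / (i < j)%N} ->
  (forall i, s i *+ p = 0) -> (forall i, s i \in @multiples A (p ^ h i)) ->
  (forall i, s i \notin @multiples A (p ^ (h i).+1)) ->
  forall N (f : nat -> int), \sum_(i < N) s i *~ f i = 0 ->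
  forall i, (i < N)%N -> (p %| f i)%Z.
Proof.
move=> p_pr h_incr sp sh sh' N f sum0; elim/ltn_ind => i IH iN.
apply: contraR (sh' i) => pf.
have [|u <-] := @coprime_divide A (s i) p (f i) _ (sp i).
  by rewrite prime_coprime // -[p]absz_nat -dvdzE.
rewrite mulrzAC; apply: rpredMz.
move: sum0; rewrite (bigD1 (Ordinal iN)) //= => /eqP; rewrite addr_eq0 => /eqP ->.
rewrite rpredN; apply: rpred_sum => j ji; have [ij|ij|ij] := ltngtP i j.
- have /asboolP[y ->] := sh j; apply/rpredMz/asboolP.
  exists (y *+ p ^ (h j - (h i).+1)).
  by rewrite -mulrnA -expnD subnK //; apply: h_incr.
- have /dvdzP[c ->] := IH j ij (ltn_ord j).
  by rewrite mulrC mulrzA -pmulrn sp mul0rz rpred0.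
- by case/eqP: ji; apply: val_inj.
Qed.

(** Reduction to the socle elements [x i *+ p ^ h i]: the relation times [p ^ r] has coefficients
    divisible by [p ^ h i], and the quotients are divisible by [p]; this lowers [r] step by step. *)
Lemma dvdz_of_independent_socle (A : zmodType) (p : nat) (x : nat -> A) (h : nat -> nat) :
  prime p -> {homo h : i j / (i < j)%N} ->
  (forall i, x i *+ p ^ (h i).+1 = 0) ->
  (forall i, x i *+ p ^ h i \notin @multiples A (p ^ (h i).+1)) ->
  forall N (e : nat -> int), \sum_(i < N) x i *~ e i = 0 ->
  forall i, (i < N)%N -> ((p ^ (h i).+1)%N %| e i)%Z.
Proof.
move=> p_pr h_incr xh xh' N e sum0.
have P0 n : (p ^ n)%N%:Z != 0 by rewrite eqz_nat -lt0n expn_gt0 prime_gt0.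
suff desc r : (forall i, (i < N)%N -> ((p ^ (h i).+1)%N %| (p ^ r)%N%:Z * e i)%Z) ->
    forall i, (i < N)%N -> ((p ^ (h i).+1)%N %| e i)%Z.
  (* Since [h i < h N], the factor [p ^ h N] alone gives the first divisibility. *)
  apply: (desc (h N)) => i iN; apply: dvdz_mulr.
  by rewrite dvdzE !absz_nat dvdn_exp2l // h_incr.
elim: r => [he i iN|r IH he]; first by rewrite -[e i]mul1r; apply: he.
apply: IH => i iN.
pose f i := ((p ^ r)%N%:Z * e i %/ (p ^ h i)%N)%Z.
have fE k : (k < N)%N -> f k * (p ^ h k)%N%:Z = (p ^ r)%N%:Z * e k.
  move=> /he; rewrite !expnS !PoszM -mulrA dvdz_mul2l; last first.
    by have := P0 1%N; rewrite expn1.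
  by move=> /divzK ->.
rewrite -fE // expnS PoszM dvdz_mul2r //.
apply: (@independent_socle A p (fun i => x i *+ p ^ h i) h p_pr h_incr _ _ xh' N f).
- by move=> k; rewrite -mulrnA -expnSr.
- by move=> k; apply/asboolP; exists (x k).
- transitivity ((\sum_(k < N) x k *~ e k) *~ (p ^ r)%N%:Z); last by rewrite sum0 mul0rz.
  rewrite mulrz_suml; apply: eq_bigr => k _.
  by rewrite pmulrn -!mulrzA [in LHS]mulrC fE // mulrC.
- exact: iN.
Qed.

Lemma primary_bounded (A : zmodType) (p : nat) :
  hereditarily_reduced A -> prime p ->
  exists k, forall (x : A) j, x *+ p ^ j = 0 -> x *+ p ^ k = 0.
Proof.
move=> red p_pr.
have p_gt0 := prime_gt0 p_pr.
have [[N soc]|nsoc] := pselect (exists N, forall (z : A) n, z *+ p = 0 ->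
    (exists y, z = y *+ p ^ N) -> exists y, z = y *+ p ^ n).
  (* [F] is the [p]-primary part of [p ^ N A], which is divisible and hence zero. *)
  have [||F FP] := @subgroup_of A
    [set a | (exists k, a *+ p ^ k = 0) /\ exists y, a = y *+ p ^ N].
  - by split; [exists 0%N | exists 0]; rewrite mul0rn.
  - move=> x y [[k xk] [a xa]] [[l yl] [b yb]]; split.
      exists (k + l)%N; rewrite mulrnBl expnD mulrnA xk mul0rn.
      by rewrite mulnC mulrnA yl mul0rn subr0.
    by exists (a - b); rewrite mulrnBl xa yb.
  have [K KP] := subgroup0 A; exists N => x j xj; apply/KP/(red F).
    move=> m f m_gt0 /FP[[k fk] fN].
    have [b [bm bt bN]] := divide_of_infinite_height p_pr soc m_gt0 fk fN.
    by exists b; [apply/FP | rewrite bm subrr rpred0].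
  apply/FP; split; last by exists x.
  by exists j; rewrite -mulrnA mulnC mulrnA xj mul0rn.
(* A socle element of finite height is written as [hy.2 *+ p ^ hy.1], where [hy.1] is its height and
   at least [N]. *)
have next N : exists hy : nat * A, [/\ (N <= hy.1)%N, hy.2 *+ p ^ hy.1.+1 = 0 &
    hy.2 *+ p ^ hy.1 \notin @multiples A (p ^ hy.1.+1)].
  have /existsNP[z /existsNP[n /not_implyP[zp /not_implyP[[y0 zN] zn]]]] :=
    (forallNP _).2 nsoc N.
  have exn : exists n, z \notin @multiples A (p ^ n).
    by exists n; apply/asboolP.
  case: (ex_minnP exn) => k zk kmin.
  have Nk : (N < k)%N.
    rewrite ltnNge; apply: contra zk => kN; apply/asboolP.
    by exists (y0 *+ p ^ (N - k)); rewrite zN -mulrnA -expnD subnK.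
  case: k => [//|k] in zk kmin Nk *.
  have /asboolP[y zy] : z \in @multiples A (p ^ k).
    by apply: contraT => /kmin; rewrite ltnn.
  exists (k, y); split=> //=; last by rewrite -zy.
  by rewrite expnSr mulrnA -zy.
have [f fP] := choice next.
(* Each search starts above the previous height, so that [h] is strictly increasing. *)
pose start i := iter i (fun N => (f N).1.+1) 0%N.
pose h i := (f (start i)).1; pose x i := (f (start i)).2.
have hS i : (h i < h i.+1)%N by have [] := fP (start i.+1).
have h_incr : {homo h : i j / (i < j)%N} by apply: (homo_ltn ltn_trans).
(* These weights map the span of the [x i] onto Z(p^oo). *)
pose w i : rat := (p ^ (h i).+1)%N%:R^-1.
have P0 n : (p ^ n)%N%:R != 0 :> rat by rewrite pnatr_eq0 -lt0n expn_gt0 p_gt0.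
suff : w 0%N \is a Num.int.
  have w0_gt0 : 0 < w 0%N by rewrite invr_gt0 ltr0n expn_gt0 p_gt0.
  move=> /norm_intr_ge1; rewrite gt_eqF // gtr0_norm // => /(_ isT).
  rewrite invf_ge1 ?ltr0n ?expn_gt0 ?p_gt0 // -[1]/(1%:R) ler_nat leqNgt.
  by rewrite -{1}(exp1n (h 0%N).+1) ltn_exp2r // prime_gt1.
apply: (@int_of_weights A x w red) => [N e sum0|m i m_gt0].
- apply: rpred_sum => i _.
  have /dvdzP[c ->] : ((p ^ (h i).+1)%N %| e i)%Z.
    apply: (dvdz_of_independent_socle p_pr h_incr _ _ sum0) => // k;
      by have [] := fP (start k).
  rewrite mulrC mulrzA -pmulrn /w -[_ *+ _]mulr_natr mulVf //.
  by rewrite rpredMz // rpred1.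
(* Since [h (i + a) >= h i + a], a power of [p] times [w (i + a)] is [w i] divided by [p ^ a]; the
   coefficient [v] inverts [n] modulo the denominator of [w i]. *)
- have [n pn mE] := pfactor_coprime p_pr m_gt0; set a := logn p m in mE.
  have ha : (h i + a <= h (i + a))%N.
    elim: (a) => [|b]; first by rewrite !addn0.
    by rewrite !addnS => /leq_ltn_trans; apply.
  have [v [t vt]] := Bezoutz n (p ^ (h i).+1)%N.
  exists (i + a)%N, (v * (p ^ (h (i + a) - (h i + a)))%N%:Z).
  have {}vt : v * n = 1 - t * (p ^ (h i).+1)%N%:Z.
    have /eqP g1 : coprime n (p ^ (h i).+1) by rewrite coprime_sym; apply: coprimeXl.
    by apply/eqP; rewrite eq_sym subr_eq vt /gcdz !absz_nat g1.
  suff -> : w (i + a)%N *~ (v * (p ^ (h (i + a) - (h i + a)))%N%:Z) *+ m = w i *~ (v * n).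
    rewrite vt mulrzBr mulr1z addrAC subrr add0r rpredN mulrC mulrzA -pmulrn.
    by rewrite /w -[_ *+ _]mulr_natr mulVf // rpredMz // rpred1.
  rewrite pmulrn -!mulrzA mE.
  have -> : v * (p ^ (h (i + a) - (h i + a)))%N%:Z * (n * p ^ a)%N%:Z
      = (p ^ (h (i + a) - h i))%N%:Z * (v * n).
    rewrite PoszM mulrACA mulrC -PoszM -expnD; congr ((p ^ _)%N%:Z * _).
    by rewrite subnDA subnK // leq_subRL ?(leq_trans (leq_addr _ _) ha).
  rewrite mulrzA; congr (_ *~ _); rewrite /w -pmulrn -[_ *+ _]mulr_natr.
  have hi : (h i <= h (i + a))%N by rewrite (leq_trans (leq_addr _ _) ha).
  have -> : (p ^ (h (i + a)).+1 = p ^ (h i).+1 * p ^ (h (i + a) - h i))%N.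
    by rewrite -expnD addSn subnKC.
  by rewrite natrM invfM -mulrA mulVf ?mulr1.
Qed.

(** * Finiteness of the torsion-free rank *)

Lemma sum_cons (A : zmodType) n (x : A) (t : n.-tuple A) (c : 'I_n.+1 -> int) :
  \sum_(i < n.+1) tnth [tuple of x :: t] i *~ c i =
  x *~ c ord0 + \sum_(i < n) tnth t i *~ c (lift ord0 i).
Proof.
by rewrite big_ord_recl tnth0; congr (_ + _); apply: eq_bigr => i _; rewrite tnthS.
Qed.

Lemma dependent_cons (A : zmodType) n (t : n.-tuple A) (x : A) :
  independent t -> ~ independent [tuple of x :: t] ->
  exists2 k : int, k != 0 & exists c : 'I_n -> int, x *~ k = \sum_(i < n) tnth t i *~ c i.
Proof.
move=> tind /existsNP[c /not_implyP[sum0 /existsNP[i ci]]]; rewrite sum_cons in sum0.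
exists (c ord0); last first.
  exists (fun i => - c (lift ord0 i)); move/eqP: sum0; rewrite addr_eq0 => /eqP ->.
  by rewrite -sumrN; apply: eq_bigr => j _; rewrite mulrNz.
apply/eqP => c0; case: ci; case: (unliftP ord0 i) => [j|] -> //.
by apply: (tind (fun j => c (lift ord0 j))); rewrite c0 mulr0z add0r in sum0.
Qed.

(** With more rows than columns, the last row of the Smith form is zero, so the last row of
    [invmx L] is a nonzero kernel vector. *)
Lemma int_row_kernel n (M : 'M[int]_(n.+1, n)) :
  exists2 v : 'rV[int]_n.+1, v != 0 & v *m M = 0.
Proof.
have [L Lu [R Ru [d _ ->]]] := int_Smith_normal_form M.
exists (row ord_max (invmx L)).
  apply/eqP => v0; have := congr1 (fun A => (row ord_max A) 0 ord_max) (mulVmx Lu).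
  by rewrite row_mul v0 mul0mx row1 !mxE !eqxx.
rewrite !mulmxA -row_mul mulVmx // -row_mul mul1mx.
rewrite [X in X *m _](_ : _ = 0) ?mul0mx //.
by apply/rowP => j; rewrite !mxE /= gtn_eqF ?mulr0n.
Qed.

(** Every [tnth u j] has a nonzero multiple in the span of [t]; a row killing the [n.+1] by [n]
    matrix of coefficients gives a relation among the [tnth u j]. *)
Lemma r0_max (A : zmodType) n (u : n.+1.-tuple A) : has_r0 A n -> ~ independent u.
Proof.
move=> [t [tind tmax]] uind.
have /choice[k kP] : forall j, exists k : int * 'rV[int]_n,
    k.1 != 0 /\ tnth u j *~ k.1 = \sum_(i < n) tnth t i *~ k.2 0 i.
  move=> j; have [a a0 [c ac]] := dependent_cons tind (tmax (tnth u j)).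
  by exists (a, \row_i c i); split=> //=; rewrite ac; apply: eq_bigr => i _; rewrite mxE.
have [v v0 vM] := int_row_kernel (\matrix_(j, i) (k j).2 0 i).
case/eqP: v0; apply/rowP => j; rewrite mxE; apply/eqP.
have /eqP : v 0 j * (k j).1 = 0.
  apply: (uind (fun j => v 0 j * (k j).1)).
  rewrite (eq_bigr (fun j => \sum_(i < n) tnth t i *~ (v 0 j * (k j).2 0 i))).
    rewrite exchange_big big1 //= => i _; rewrite -mulrz_sumr.
    have := congr1 (fun B : 'rV_n => B 0 i) vM; rewrite !mxE.
    by under eq_bigr do rewrite mxE; move=> ->; rewrite mulr0z.
  move=> l _; rewrite mulrC mulrzA (kP l).2 mulrz_suml; apply: eq_bigr => i _.
  by rewrite -mulrzA mulrC.
by rewrite mulf_eq0 (negPf (kP j).1) orbF.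
Qed.

Lemma r0_exists (A : zmodType) : hereditarily_reduced A -> exists n, has_r0 A n.
Proof.
move=> red; apply: contrapT => nr0.
pose free (s : seq A) := forall e : nat -> int,
  \sum_(k < size s) s`_k *~ e k = 0 -> forall k, (k < size s)%N -> e k = 0.
(* The default [0] for a dependent [s] makes the extension a total function, which can be
   iterated. *)
have ext s : exists y, free s -> free (rcons s y).
  have [sfree|] := pselect (free s); last by exists 0.
  have sind : independent (in_tuple s).
    move=> c sum0 i; have := sfree (fun k => oapp c 0 (insub k)) _ i (ltn_ord i).
    rewrite valK /=; apply; rewrite -[RHS]sum0; apply: eq_bigr => j _.
    by rewrite valK (tnth_nth 0).
  have /existsNP[y /contrapT yind] : ~ forall y, ~ independent [tuple of y :: in_tuple s].
    by move=> smax; apply: nr0; exists (size s), (in_tuple s).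
  exists y => _ e; rewrite size_rcons big_ord_recr /= nth_rcons ltnn eqxx => sum0 k.
  (* The new element comes last in [rcons s y] but first in [y :: s]; [c] moves its coefficient to
     the front. *)
  pose c i := oapp (fun j : 'I_(size s) => e j) (e (size s)) (unlift ord0 i).
  have c0 : forall i, c i = 0.
    apply: yind; rewrite sum_cons /c unlift_none -[RHS]sum0 addrC; congr (_ + _).
    apply: eq_bigr => i _; rewrite liftK /= nth_rcons ltn_ord.
    by rewrite (tnth_nth 0).
  rewrite ltnS leq_eqVlt => /predU1P[->|kn].
    by have := c0 ord0; rewrite /c unlift_none.
  by have := c0 (lift ord0 (Ordinal kn)); rewrite /c liftK.
have [g gP] := choice ext.
pose S i := iter i (fun s => rcons s (g s)) [::]; pose x i := g (S i).
have Sfree i : free (S i) by elim: i => [e _ k //|i IH]; apply: gP.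
have SE i : S i = mkseq x i by elim: i => // i IH; rewrite mkseqS -IH.
(* The weights [1 / (i+2)!] start at [1/2], which is not an integer. *)
suff : (2`!%:R^-1 : rat) \is a Num.int by [].
apply: (@int_of_weights A x (fun i => (i.+2)`!%:R^-1) red _ _ 0%N) => [N e|m i m_gt0].
  move=> sum0; rewrite big1 ?rpred0 // => i _.
  rewrite (Sfree N e) ?mulr0z ?SE ?size_mkseq // -[RHS]sum0.
  by apply: eq_bigr => k _; rewrite nth_mkseq.
(* Here [m] becomes [m.+1]; since [(i+m+3)!] is the binomial times [(m+1)! (i+2)!], the chosen
   multiple of a later weight, times [m.+1], is the weight at [i]. *)
case: m m_gt0 => // m _; exists (i + m.+1)%N, ('C((i + m.+1).+2, m.+1) * m`!)%N%:Z.
rewrite -pmulrn -mulrnA -mulnA (mulnC m`!) -factS.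
rewrite [X in X - _](_ : _ = (i.+2)`!%:R^-1) ?subrr ?rpred0 //.
have le : (m.+1 <= (i + m.+1).+2)%N by rewrite -addSn -addSn leq_addl.
rewrite -(bin_fact le) -addSn -addSn addnK -[_ *+ _]mulr_natl.
have F0 k : k`!%:R != 0 :> rat by rewrite pnatr_eq0 -lt0n fact_gt0.
have C0 : 'C(i.+2 + m.+1, m.+1)%:R != 0 :> rat by rewrite pnatr_eq0 -lt0n bin_gt0 leq_addl.
move: (F0 m.+1) C0; move: (m.+1)`! (i.+2)`! 'C(_, _) => a b c a0 c0; rewrite !natrM.
by rewrite mulrA invfM mulrA divff ?mul1r // mulf_neq0.
Qed.

(** * Primary decomposition of locally bounded groups *)

(* [locally_bounded A] says at once that [A] is torsion and that its primary
   components are bounded, in a form that passes to quotients trivially. *)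
Definition locally_bounded (A : zmodType) : Prop :=
  forall p, prime p -> exists k, forall x : A,
    exists2 m, coprime p m & x *+ (m * p ^ k) = 0.

Lemma isomorphic_of (A B : zmodType) (f : A -> B) :
  (forall x y, f (x - y) = f x - f y) -> injective f ->
  (forall y, exists x, f x = y) -> isomorphic A B.
Proof.
move=> fB f_inj /choice[g gK].
pose F : {additive A -> B} := HB.pack f (GRing.isZmodMorphism.Build A B f fB).
by exists F; exists g => // x; apply: f_inj; rewrite gK.
Qed.

Lemma direct_product_mulrn (I : Type) (M : I -> zmodType) (f : direct_product M) n i :
  (f *+ n) i = f i *+ n.
Proof. by elim: n => [|n IH]; rewrite ?mulr0n // !mulrS -IH. Qed.

(** The exponent of [p] comes from the bound on [B p], and [m] is a product of prime powers killing
    the other nonzero components of [x], which are finitely many. *)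
Lemma locally_bounded_of_sum (A : zmodType) :
  sum_of_bounded_pgroups A -> locally_bounded A.
Proof.
move=> [B [BP [f /bij_inj f_inj]]] p p_pr.
have [_ [m0 m0_gt0 Bm0]] := BP (exist _ p p_pr).
have [n pn m0E] := pfactor_coprime p_pr m0_gt0.
exists (logn p m0) => x.
pose y : direct_product B := val (f x).
have /asboolP/finite_seqP[s sE] : y \in Defs.finite_support (M:=B) := valP (f x).
have [m pm ms] : exists2 m, coprime p m &
    forall q, q \in s -> val q != p -> y q *+ m = 0.
  elim: (s) => [|q r [m pm mr]]; first by exists 1%N; rewrite ?coprimen1.
  have [qp|qp] := eqVneq (val q) p.
    by exists m => // q'; rewrite inE => /predU1P[->|/mr//]; rewrite qp eqxx.
  have [k qk] := (BP q).1 (y q).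
  exists (m * val q ^ k)%N.
    rewrite coprimeMr pm coprimeXr // prime_coprime // dvdn_prime2 ?(valP q) //.
    by rewrite eq_sym.
  move=> q'; rewrite inE => /predU1P[-> _|/mr q'm /q'm e].
    by rewrite mulnC mulrnA qk mul0rn.
  by rewrite mulrnA e mul0rn.
exists m => //; apply: f_inj; rewrite raddf0 raddfMn; apply: val_inj.
rewrite raddfMn raddf0; apply: functional_extensionality_dep => q.
rewrite direct_product_mulrn mulnC mulrnA.
rewrite -[LHS]/(y q *+ p ^ logn p m0 *+ m) -[RHS]/(0 : B q).
have [q0|q0] := eqVneq (y q) 0; first by rewrite q0 !mul0rn.
have qs : q \in s by have : [set` s] q by rewrite -sE.
have [qp|qp] := eqVneq (val q) p; last by rewrite -mulrnA mulnC mulrnA (ms q) ?mul0rn.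
have {qp} -> : q = exist _ p p_pr by apply: val_inj.
rewrite [X in X *+ m](_ : _ = 0) ?mul0rn //.
set z := y _; have [k zk] := (BP (exist _ p p_pr)).1 z.
apply: (@eq0_coprime _ _ (p ^ k) n); first exact: coprimeXl.
  by rewrite -mulrnA mulnC mulrnA zk mul0rn.
by rewrite -mulrnA mulnC -m0E Bm0.
Qed.

(** Each [x] is the sum of [c (p, x)] in the [p]-primary part [T p] and an element of [C p], whose
    order is prime to [p]. As [T p] and [C p] meet in zero, [c] is a projection for each [p], and
    the family of projections is the isomorphism. *)
Lemma sum_of_locally_bounded (A : zmodType) :
  locally_bounded A -> sum_of_bounded_pgroups A.
Proof.
move=> lb; pose I := {p : nat | prime p}.
have /choice[T TP] : forall p : I, exists T : zmodClosed A,
    forall x, x \in T <-> exists k, x *+ val p ^ k = 0.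
  move=> p; apply: subgroup_of; first by exists 0%N; rewrite mul0rn.
  move=> x y [k xk] [l yl]; exists (k + l)%N.
  by rewrite mulrnBl expnD mulrnA xk mul0rn mulnC mulrnA yl mul0rn subr0.
have /choice[C CP] : forall p : I, exists C : zmodClosed A,
    forall x, x \in C <-> exists2 m, coprime (val p) m & x *+ m = 0.
  move=> p; apply: subgroup_of; first by exists 1%N; rewrite ?coprimen1.
  move=> x y [m pm xm] [n pn yn]; exists (m * n)%N; first by rewrite coprimeMr pm.
  by rewrite mulrnBl mulrnA xm mul0rn mulnC mulrnA yn mul0rn subr0.
have TC p x : x \in T p -> x \in C p -> x = 0.
  move=> /TP[k xk] /CP[m pm xm]; apply: (@eq0_coprime _ _ (val p ^ k) m) => //.
  exact: coprimeXl.
have torsion (x : A) : exists2 m, (0 < m)%N & x *+ m = 0.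
  (* Since [0] is not coprime to [2], the multiplier found at [2] is positive. *)
  have [k /(_ x)[[//|m] _ xm]] := lb 2 isT.
  by exists (m.+1 * 2 ^ k)%N; rewrite // muln_gt0 expn_gt0.
have /choice[c cP] : forall px : I * A, exists c, c \in T px.1 /\ px.2 - c \in C px.1.
  move=> [p x] /=; have [m m_gt0 xm] := torsion x.
  have [n pn mE] := pfactor_coprime (valP p) m_gt0; set k := logn _ _ in mE.
  have [u [v uv]] := Bezoutz (val p ^ k)%N n.
  exists (x *~ (v * n)); split.
    apply/TP; exists k; rewrite mulrC mulrzA pmulrn mulrzAC -!pmulrn -mulrnA -mE.
    by rewrite xm mul0rz.
  apply/CP; exists n => //.
  have -> : x - x *~ (v * n) = x *+ (val p ^ k) *~ u.
    apply/eqP; rewrite subr_eq pmulrn -mulrzA -mulrzDr (mulrC _ u) uv.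
    have /eqP : coprime (val p ^ k) n by apply: coprimeXl.
    by rewrite /gcdz !absz_nat => ->; rewrite mulr1z.
  by rewrite pmulrn mulrzAC -pmulrn -mulrnA mulnC -mE xm mul0rz.
have cT p x : c (p, x) \in T p by have [] := cP (p, x).
have c_uniq p x y : y \in T p -> x - y \in C p -> c (p, x) = y.
  move=> yT yC; have [cT' cC] := cP (p, x); apply/eqP; rewrite -subr_eq0; apply/eqP.
  apply: (TC p); first by rewrite rpredB.
  have -> : c (p, x) - y = (x - y) - (x - c (p, x)); last by rewrite rpredB.
  by rewrite opprB [RHS]addrC addrA subrK.
pose B (p : I) : zmodType := subgroup_type (T p).
pose F0 (x : A) : direct_product B := fun p => exist _ (c (p, x)) (cT p x).
have F0B x y : F0 (x - y) = F0 x - F0 y.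
  apply: functional_extensionality_dep => p; apply: val_inj => /=.
  rewrite -[RHS]/(c (p, x) - c (p, y)); apply: c_uniq; first by rewrite rpredB.
  have [[_ xC] [_ yC]] := (cP (p, x), cP (p, y)).
  by rewrite subrACA rpredB.
have F0fin x : F0 x \in Defs.finite_support (M:=B).
  apply/asboolP; have [m m_gt0 xm] := torsion x.
  apply: (@sub_finite_set _ _ (val @^-1` [set` primes m])).
    move=> p /=; apply: contraR; rewrite mem_primes m_gt0 (valP p) /= => pm.
    apply/eqP/val_inj => /=; apply: c_uniq; first by rewrite rpred0.
    by rewrite subr0; apply/CP; exists m; rewrite // prime_coprime // (valP p).
  by apply: finite_preimage; [move=> p q _ _; apply: val_inj | apply: finite_seq].
exists B; split.
  move=> p; split=> [x|].
    have /TP[k xk] := valP x; exists k; apply: val_inj.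
    by rewrite raddfMn raddf0.
  have [k lbk] := lb _ (valP p); exists (val p ^ k)%N.
    by rewrite expn_gt0 prime_gt0 // (valP p).
  move=> x; apply: val_inj; rewrite raddfMn raddf0; have [m pm xm] := lbk (val x).
  apply: (TC p); first by rewrite rpredMn // (valP x).
  by apply/CP; exists m; rewrite // -mulrnA mulnC.
apply: (@isomorphic_of _ _ (fun x => exist _ (F0 x) (F0fin x) : direct_sum B)).
- by move=> x y; apply: val_inj => /=; rewrite F0B.
- move=> x y /(congr1 val) /= xy.
  apply/eqP; rewrite -subr_eq0; apply/eqP/eq0_local => p p_pr.
  pose P : I := exist _ p p_pr.
  have /(congr1 val) /= e : F0 (x - y) P = 0 by rewrite F0B xy subrr.
  have [_] := cP (P, x - y); rewrite e subr0 => /CP[m pm xym].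
  by exists m.
move=> g; have /asboolP/finite_seqP[s sE] := valP g.
(* [undup] counts each component once; those at primes other than [p] lie in [C p]. *)
exists (\sum_(q <- undup s) val (val g q)); apply: val_inj => /=.
apply: functional_extensionality_dep => p; apply: val_inj => /=.
apply: c_uniq; first exact: valP.
have gC q : q != p -> val (val g q) \in C p.
  move=> qp; have /TP[k gk] := valP (val g q); apply/CP; exists (val q ^ k)%N => //.
  by rewrite coprimeXr // prime_coprime ?(valP p) // dvdn_prime2 ?(valP p) ?(valP q) // eq_sym.
have [ps|ps] := boolP (p \in undup s).
  rewrite (bigD1_seq p) ?undup_uniq //= addrC addrK.
  by apply: rpred_sum => q; apply: gC.
have -> : val g p = 0.
  apply/eqP; apply: contraNT ps => gp; rewrite mem_undup.
  by have : [set i | val g i != 0] p by []; rewrite sE.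
rewrite subr0 big_seq; apply: rpred_sum => q qs; apply: gC.
by apply: contraNneq ps => <-.
Qed.

Lemma locally_bounded_quotP (G : zmodType) (F : zmodClosed G) :
  locally_bounded {quot F} <->
  forall p, prime p -> exists k, forall x,
    exists2 m, coprime p m & x *+ (m * p ^ k) \in F.
Proof.
split=> lb p /lb[k kP]; exists k => x.
  have [m pm xm] := kP (\pi_({quot F})%qT x); exists m => //.
  by rewrite -pi_eq0 raddfMn /= xm.
have [m pm xm] := kP (repr x); exists m => //; apply/eqP.
by rewrite -[x]reprK -raddfMn /= pi_eq0.
Qed.

(** * Closedness and cofinality conditions *)

Lemma proper_subgroupP (G : zmodType) (H : zmodClosed G) :
  proper_subgroup H <-> exists x, x \notin H.
Proof.
rewrite /proper_subgroup properEneq; split=> [[HT _]|[x xH]].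
  apply: contrapT => nx; move/eqP: HT; apply; apply/seteqP; split=> // x _ /=.
  by apply: contraT => xH; case: nx; exists x.
split=> //; apply/eqP => HT; have : [set: G] x by [].
by rewrite -HT /= (negPf xH).
Qed.

Lemma linear_closedP (G : zmodType) (B : subgroup_base G) (X : set G) :
  closed (X : set (linear_topology B)) <->
  forall x, ~ X x -> exists2 K, base_subgroups B K & forall h, h \in K -> ~ X (x + h).
Proof.
rewrite -openC openE; split=> [cl x Xx|cl x Xx]; last exact: cl.
by have [K BK KX] := cl x Xx; exists K.
Qed.

(** A coordinate of the embedding separates [x] from [H]; its kernel [K] has finite index and
    [x + K] misses [H]. *)
Lemma profinite_closed_of_residually_finite (G : zmodType) (H : zmodClosed G) :
  residually_finite {quot H} -> profinite_closed [set` H].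
Proof.
move=> [I [F [S [f /bij_inj f_inj]]]]; apply/linear_closedP => x /negP xH.
pose g i (y : G) : F i := (val (f (\pi_({quot H})%qT y)) : direct_product F) i.
have gB i y z : g i (y - z) = g i y - g i z.
  by rewrite /g !raddfB.
have g0 i y : y \in H -> g i y = 0.
  by move=> /pi_eq0P yH; rewrite /g yH raddf0 raddf0.
have [i gi] : exists i, g i x != 0.
  apply: contrapT => ng; move: xH; rewrite -pi_eq0 => /eqP; apply.
  apply: f_inj; rewrite raddf0; apply: val_inj; rewrite raddf0.
  apply: functional_extensionality_dep => i; apply/eqP.
  by apply: contraT => gi; case: ng; exists i.
have [|y z yK zK|K KP] := @subgroup_of G [set y | g i y = 0].
- by rewrite /= g0 ?rpred0.
- by rewrite /= gB yK zK subrr.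
exists K; last first.
  move=> h /KP hK xhH; case/eqP: gi; have := g0 i _ xhH.
  by rewrite -{1}[h]opprK gB -(sub0r h) gB hK (g0 i 0) ?rpred0 // !subr0.
rewrite /= /finite_index -(preimage_setT (fun q : {quot K} => g i (repr q))).
apply: finite_preimage => [q r _ _ /= qr|]; last exact: finite_finset.
apply/eqP; rewrite -subr_eq0 -[q]reprK -[r]reprK -raddfB /= pi_eq0.
by apply/KP; rewrite /= gB qr subrr.
Qed.

(** A finite-index subgroup contains some [mG], so the natural topology is finer. *)
Lemma natural_closed_of_profinite_closed (G : zmodType) (X : set G) :
  profinite_closed X -> natural_closed X.
Proof.
move=> /linear_closedP cl; apply/linear_closedP => x /cl[K Kfin KX].
have [m m_gt0 mK] := finite_index_multiples Kfin.
exists (multiples m : zmodClosed G); first by exists m.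
by move=> _ /asboolP[y ->]; apply: KX.
Qed.

(** If [G / H] were divisible, every [x + mG] would meet [H]. *)
Lemma strongly_non_divisible_of_natural_closed (G : zmodType) :
  (forall H : zmodClosed G, natural_closed [set` H]) -> strongly_non_divisible G.
Proof.
move=> cl H /proper_subgroupP[x xH] /divisible_quotP div.
have /linear_closedP/(_ x (negP xH))[K [m m_gt0 ->] mH] := cl H.
have [y yH] := div m x m_gt0; apply: (mH (- (y *+ m))).
  by apply/asboolP; exists (- y); rewrite mulNrn.
by rewrite /= -opprB rpredN.
Qed.

(** A finite quotient of a divisible group is divisible and killed by some positive [m], hence
    zero. *)
Lemma strongly_non_divisible_of_cofinal (G : zmodType) :
  (forall H : zmodClosed G, proper_subgroup H ->
     exists N : zmodClosed G,
       [/\ proper_subgroup N, finite_index N & [set` H] `<=` [set` N]]) ->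
  strongly_non_divisible G.
Proof.
move=> cof H /cof[N [/proper_subgroupP[x xN] Nfin HN]] /divisible_quotP div.
have [m m_gt0 mN] := finite_index_multiples Nfin.
have [y yH] := div m x m_gt0.
by rewrite -(subKr (y *+ m) x) rpredB // in xN; apply: HN.
Qed.

(** * Embedding into a product of finite quotients *)

(* [Afin] is an argument of the alias so that instances can be inferred from it. *)
Definition finite_copy (A : zmodType) (Afin : finite_set [set: A]) : Type := A.

Section FiniteCopy.
Variables (A : zmodType) (Afin : finite_set [set: A]).
Local Notation C := (finite_copy Afin).

HB.instance Definition _ := GRing.Zmodule.on C.

Let s : seq A := undup (sval (cid ((finite_seqP _).1 Afin))).

Let mem_s x : x \in s.
Proof.
rewrite mem_undup; case: cid => r /= rE.
by have : [set: A] x by []; rewrite rE.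
Qed.

Let s_index : pcancel (index^~ s) (fun n => ohead (drop n s)).
Proof. by move=> x; rewrite (drop_nth x) ?index_mem //= nth_index. Qed.

HB.instance Definition _ : isCountable C := PCanIsCountable s_index.

Let s_enum : Finite.axiom (s : seq C).
Proof. by move=> x; rewrite count_uniq_mem ?undup_uniq // mem_s. Qed.

HB.instance Definition _ := isFinite.Build C s_enum.
End FiniteCopy.

(** The embedding collects the maps to all finite [G / M] with [M] above [H]; separation makes it
    injective. *)
Lemma residually_finite_of_separated (G : zmodType) (H : zmodClosed G) :
  residually_separated G -> residually_finite {quot H}.
Proof.
move=> sep.
pose I := {M : zmodClosed G | finite_index M /\ {subset H <= M}}.
pose F (i : I) : finZmodType := finite_copy (svalP i).1.
pose f (q : {quot H}) : direct_product F := fun i => \pi_({quot (sval i)})%qT (repr q).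
have fB q r : f (q - r) = f q - f r.
  apply: functional_extensionality_dep => i; rewrite -[RHS]/(f q i - f r i).
  apply/eqP; rewrite -subr_eq0 /f -!raddfB /= pi_eq0; apply: (svalP i).2.
  by rewrite -pi_eq0 raddfB (raddfB _ (repr q)) /= !reprK subrr.
have f_inj : injective f.
  move=> q r qr; apply/eqP; rewrite -subr_eq0 -[q - r]reprK pi_eq0.
  apply: contraT => /sep[M [Mfin HM]]; pose i : I := exist _ M (conj Mfin HM).
  have : f (q - r) i = 0 by rewrite fB qr subrr.
  by move=> /pi_eq0P ->.
have [|y z [q <-] [r <-]|S SP] := @subgroup_of (direct_product F) [set y | exists q, f q = y].
- by exists 0; rewrite -[0 in LHS](subrr 0) fB subrr.
- by exists (q - r); rewrite fB.
exists I, F, S.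
have fS q : f q \in S by apply/SP; exists q.
apply: (@isomorphic_of _ _ (fun q => exist _ (f q) (fS q) : subgroup_type S)).
- by move=> q r; apply: val_inj => /=; rewrite fB.
- by move=> q r /(congr1 val) /f_inj.
by move=> [y yS]; have /SP[q qy] := yS; exists q; apply: val_inj.
Qed.

(** * Free subgroups of full rank *)

Lemma lin_indep_val (G : zmodType) (F : zmodClosed G) n (t : n.-tuple (subgroup_type F)) :
  independent [tuple of map val t] <-> independent t.
Proof.
have sumE (c : 'I_n -> int) : \sum_(i < n) tnth [tuple of map val t] i *~ c i =
    val (\sum_(i < n) tnth t i *~ c i).
  by rewrite raddf_sum; apply: eq_bigr => i _; rewrite tnth_map raddfMz.
split=> tind c sum0; apply: tind; first by rewrite sumE sum0 raddf0.
by apply: val_inj; rewrite -sumE sum0 raddf0.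
Qed.

Lemma tuple_span (G : zmodType) n (t : n.-tuple G) :
  exists F : zmodClosed G, forall z,
    z \in F <-> exists c : 'I_n -> int, z = \sum_(i < n) tnth t i *~ c i.
Proof.
apply: subgroup_of; first by exists (fun=> 0); rewrite big1 // => i _; rewrite mulr0z.
move=> _ _ [c ->] [d ->]; exists (fun i => c i - d i).
by rewrite -sumrB; apply: eq_bigr => i _; rewrite mulrzBr.
Qed.

Section FreeSpan.
Variables (G : zmodType) (n : nat) (t : n.-tuple G) (F : zmodClosed G).
Hypothesis tind : independent t.
Hypothesis FP : forall z,
  z \in F <-> exists c : 'I_n -> int, z = \sum_(i < n) tnth t i *~ c i.

Lemma mem_free_span i : tnth t i \in F.
Proof.
apply/FP; exists (fun j => (j == i)%:Z); rewrite (bigD1 i) //= eqxx mulr1z.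
by rewrite big1 ?addr0 // => j /negPf ->; rewrite mulr0z.
Qed.

Lemma free_span_isomorphic : isomorphic (subgroup_type F) 'rV[int]_n.
Proof.
have /choice[c cP] : forall z : subgroup_type F, exists v : 'rV[int]_n,
    val z = \sum_(i < n) tnth t i *~ v 0 i.
  move=> z; have /FP[c zc] := valP z; exists (\row_i c i).
  by rewrite zc; apply: eq_bigr => i _; rewrite mxE.
have c_uniq z (v : 'rV[int]_n) : val z = \sum_(i < n) tnth t i *~ v 0 i -> c z = v.
  rewrite cP => e; apply/rowP => i; apply/eqP; rewrite -subr_eq0; apply/eqP.
  apply: (tind (c := fun i => c z 0 i - v 0 i)).
  by under eq_bigr do rewrite mulrzBr; rewrite sumrB e subrr.
apply: (@isomorphic_of _ _ c).
- move=> y z; apply: c_uniq; rewrite raddfB /= !cP -sumrB.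
  by apply: eq_bigr => i _; rewrite !mxE mulrzBr.
- by move=> y z yz; apply: val_inj; rewrite !cP yz.
move=> v; have vF : \sum_(i < n) tnth t i *~ v 0 i \in F by apply/FP; exists (v 0).
by exists (exist (fun z : G => z \in F) _ vF); apply: c_uniq.
Qed.

Lemma free_span_r0 : has_r0 G n -> has_r0 (subgroup_type F) n.
Proof.
move=> r0.
pose u := [tuple exist (fun z : G => z \in F) _ (mem_free_span i) : subgroup_type F | i < n].
have uE : [tuple of map val u] = t.
  by apply: eq_from_tnth => i; rewrite tnth_map tnth_mktuple.
exists u; split; first by apply/lin_indep_val; rewrite uE.
by move=> x /lin_indep_val; apply: r0_max.
Qed.
End FreeSpan.

Lemma mulmxz_entry m n (A : 'M[int]_(m, n)) (k : int) i j : (A *~ k) i j = A i j * k.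
Proof.
have entryB : zmod_morphism (fun B : 'M[int]_(m, n) => B i j).
  by move=> B C; rewrite !mxE.
pose entry : {additive 'M[int]_(m, n) -> int} := HB.pack (fun B : 'M[int]_(m, n) => B i j)
  (GRing.isZmodMorphism.Build _ _ _ entryB).
by rewrite [LHS](raddfMz entry) -mulrzr intz.
Qed.

(** A basis of [F] is independent in [G]; adjoining [x] exceeds the rank, so a nonzero multiple of
    [x] lies in [F]. *)
Lemma torsion_quot (G : zmodType) (F : zmodClosed G) n x :
  has_r0 G n -> isomorphic (subgroup_type F) 'rV[int]_n ->
  exists2 k, (0 < k)%N & x *+ k \in F.
Proof.
move=> r0 [f [g fK gK]].
pose t := [tuple g (delta_mx 0 i) | i < n].
have tind : independent t.
  move=> c sum0 i; have /(congr1 (fun v : 'rV_n => v 0 i)) := congr1 f sum0.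
  rewrite raddf0 raddf_sum summxE mxE (bigD1 i) //= big1.
    by rewrite addr0 raddfMz tnth_mktuple gK mulmxz_entry !mxE !eqxx mul1r.
  by move=> j ji; rewrite raddfMz tnth_mktuple gK mulmxz_entry !mxE eq_sym (negPf ji) mul0r.
have vind : independent [tuple of map val t] by apply/lin_indep_val.
have [k k0 [c xk]] := dependent_cons vind (@r0_max _ _ [tuple of x :: map val t] r0).
exists `|k|%N; first by rewrite absz_gt0.
apply: rpred_absz; rewrite xk; apply: rpred_sum => i _.
by rewrite tnth_map rpredMz // (valP (tnth t i)).
Qed.

Lemma sum_of_bounded_of_separated (G : zmodType) n (F : zmodClosed G) :
  residually_separated G -> has_r0 G n ->
  isomorphic (subgroup_type F) 'rV[int]_n -> sum_of_bounded_pgroups {quot F}.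
Proof.
move=> sep r0 iso; apply: sum_of_locally_bounded => p p_pr.
have red := hereditarily_reduced_quot (H := F) (hereditarily_reduced_of_separated sep).
have [k kP] := primary_bounded red p_pr; exists k => q.
have [o o_gt0 qo] := torsion_quot (repr q) r0 iso.
have [m pm oE] := pfactor_coprime p_pr o_gt0; exists m => //.
rewrite mulrnA; apply: (kP _ (logn p o)); rewrite -mulrnA -oE.
by rewrite -[q]reprK -raddfMn; apply/pi_eq0P.
Qed.

Lemma sum_of_bounded_mono (G : zmodType) (F K : zmodClosed G) :
  {subset F <= K} -> sum_of_bounded_pgroups {quot F} -> sum_of_bounded_pgroups {quot K}.
Proof.
move=> FK /locally_bounded_of_sum/locally_bounded_quotP lb.
apply/sum_of_locally_bounded/locally_bounded_quotP => p /lb[k kP]; exists k => x.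
by have [m pm /FK xm] := kP x; exists m.
Qed.

(** * Return to strong non-divisibility by an odd determinant *)

(** Modulo [2] the matrix is the identity, so the determinant is odd. *)
Lemma det_one_sub_double n (M : 'M[int]_n) : \det (1%:M - M *+ 2) != 0.
Proof.
apply/eqP => /(congr1 (fun z : int => z%:~R : 'F_2)); rewrite -det_map_mx.
rewrite [map_mx _ _](_ : _ = 1%:M) ?det1 ?rmorph0 => [/eqP|]; first by rewrite oner_eq0.
apply/matrixP => i j; rewrite !mxE rmorphB rmorph_nat rmorphD /=.
by rewrite (addrr_pchar2 (pchar_Fp (isT : prime 2))) subr0.
Qed.

(* Multiply the relations by the adjugate of [B]. *)
Lemma rpred_det (G : zmodType) (H : zmodClosed G) n (t : 'I_n -> G) (B : 'M[int]_n) :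
  (forall i, \sum_(j < n) t j *~ B i j \in H) -> forall k, t k *~ \det B \in H.
Proof.
move=> BH k.
have -> : t k *~ \det B = \sum_(i < n) (\sum_(j < n) t j *~ B i j) *~ \adj B k i.
  under eq_bigr do rewrite mulrz_suml.
  rewrite exchange_big /=.
  rewrite (eq_bigr (fun j => t j *~ (\adj B *m B) k j)) => [|j _].
    rewrite mul_adj_mx (bigD1 k) //= !mxE eqxx big1 ?addr0 // => j jk.
    by rewrite mxE eq_sym (negPf jk) mulr0z.
  by rewrite mxE mulrz_sumr; apply: eq_bigr => i _; rewrite mulrC mulrzA.
by apply: rpred_sum => i _; apply: rpredMz.
Qed.

Lemma strongly_non_divisible_of_locally_bounded
    (G : zmodType) n (t : n.-tuple G) (F : zmodClosed G) :
  (forall z, z \in F <-> exists c : 'I_n -> int, z = \sum_(i < n) tnth t i *~ c i) ->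
  locally_bounded {quot F} -> strongly_non_divisible G.
Proof.
move=> FP /locally_bounded_quotP lb H /proper_subgroupP[x xH] /divisible_quotP div.
have [|u v [a aF aH] [b bF bH]|L LP] :=
  @subgroup_of G [set z | exists2 y, y \in F & z - y \in H].
- by exists 0; rewrite ?subrr rpred0.
- by exists (a - b); [rewrite rpredB | rewrite subrACA rpredB].
(* [L], which is [F + H], is all of [G]: modulo [H], [z] is [y *+ p ^ k], which some [m] prime to
   [p] takes into [F]. *)
have LT z : z \in L.
  apply: rpred_local => p p_pr; have [k kP] := lb p p_pr.
  have [y yH] := div (p ^ k)%N z ltac:(by rewrite expn_gt0 prime_gt0).
  have [m pm ym] := kP y; exists m => //; apply/LP.
  exists (y *+ (m * p ^ k)) => //.
  by rewrite mulnC mulrnA -mulrnBl rpredMn // -opprB rpredN.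
(* Halving [tnth t i] modulo [H] and moving the half into [F] writes it, modulo [H], as the double
   of an integer combination of [t]. *)
have /choice[c cP] : forall i, exists r : 'rV[int]_n,
    tnth t i - (\sum_(j < n) tnth t j *~ r 0 j) *+ 2 \in H.
  move=> i; have [y yH] := div 2 (tnth t i) isT.
  have /LP[z /FP[c ->] zH] := LT y; exists (\row_j c j).
  under eq_bigr do rewrite mxE.
  set s := \sum_(j < n) _ in zH *.
  have -> : tnth t i - s *+ 2 = (y - s) *+ 2 - (y *+ 2 - tnth t i).
    by rewrite mulrnBl [RHS]subrACA subrr sub0r opprB.
  by rewrite rpredB ?rpredMn.
(* The rows of [B] are relations among the [tnth t i] modulo [H]. *)
pose B : 'M[int]_n := 1%:M - (\matrix_(i, j) c i 0 j) *+ 2.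
have dH : forall k, tnth t k *~ \det B \in H.
  apply: rpred_det => i; have := cP i; congr (_ \in H).
  rewrite -sumrMnl [in RHS](eq_bigr (fun j =>
    tnth t j *~ (i == j)%:R - tnth t j *~ c i 0 j *+ 2)) => [|j _].
    rewrite sumrB; congr (_ - _).
    rewrite (bigD1 i) //= eqxx mulr1z big1 ?addr0 // => j /negPf.
    by rewrite eq_sym => ->; rewrite mulr0z.
  by rewrite !mxE mulrzBr; congr (_ - _); rewrite mulr2n mulrzDr.
have FdH z : z \in F -> z *+ `|\det B|%N \in H.
  move=> /FP[c' ->]; rewrite -sumrMnl; apply: rpred_sum => i _.
  by rewrite pmulrn mulrzAC rpredMz // -pmulrn; apply: rpred_absz.
(* The determinant kills [F] modulo [H], hence all of [G / H], where [x] is one of its multiples. *)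
case/negP: xH; have [y yH] := div `|\det B|%N x ltac:(by rewrite absz_gt0 det_one_sub_double).
rewrite -(subKr (y *+ `|\det B|%N) x) rpredB //.
have /LP[z zF zH] := LT y.
by rewrite -(subrK z y) mulrnDl; apply: rpredD; [apply: rpredMn | apply: FdH].
Qed.

Theorem theorem3p10 (G : zmodType) :
  [<-> (* (a) *)
       forall H : zmodClosed G, residually_finite {quot H};
       (* (b) *)
       forall H : zmodClosed G, profinite_closed [set` H];
       (* (c) *)
       forall H : zmodClosed G, natural_closed [set` H];
       (* (d) *)
       strongly_non_divisible G;
       (* (e) *)
       exists n : nat, has_r0 G n /\
         forall F : zmodClosed G,
           isomorphic (subgroup_type F) 'rV[int]_n ->
           sum_of_bounded_pgroups {quot F};
       (* (f) *)
       exists n : nat, has_r0 G n /\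
         forall F : zmodClosed G,
           has_r0 (subgroup_type F) n ->
           sum_of_bounded_pgroups {quot F};
       (* (g) *)
       forall H : zmodClosed G, proper_subgroup H ->
         exists N : zmodClosed G,
           [/\ proper_subgroup N, finite_index N & [set` H] `<=` [set` N]]].
Proof.
(* Kept apart from the cycle because the step from (f) to (g) passes through (d). *)
have snd_of_f : (exists n : nat, has_r0 G n /\ forall F : zmodClosed G,
    has_r0 (subgroup_type F) n -> sum_of_bounded_pgroups {quot F}) ->
    strongly_non_divisible G.
  move=> [n [r0 sum]]; have [t [tind _]] := r0; have [F FP] := tuple_span t.
  apply: (strongly_non_divisible_of_locally_bounded FP); apply: locally_bounded_of_sum.
  exact: sum (free_span_r0 tind FP r0).
tfae.
- by move=> a H; apply/profinite_closed_of_residually_finite/a.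
- by move=> b H; apply: natural_closed_of_profinite_closed; apply: b.
- exact: strongly_non_divisible_of_natural_closed.
- move=> /residually_separated_of_strongly_non_divisible sep.
  have [n r0] := r0_exists (hereditarily_reduced_of_separated sep).
  exists n; split=> [//|F iso]; exact: sum_of_bounded_of_separated iso.
(* A maximal independent tuple of [F] spans a free [K] inside [F], and [G / F] is a quotient of
   [G / K]. *)
- move=> [n [r0 sum]]; exists n; split=> // F [t [tind _]].
  have vind : independent [tuple of map val t] by apply/lin_indep_val.
  have [K KP] := tuple_span [tuple of map val t].
  apply: (sum_of_bounded_mono (F := K)); last first.
    exact/sum/(free_span_isomorphic vind KP).
  move=> z /KP[c ->]; apply: rpred_sum => i _.
  by rewrite tnth_map rpredMz // (valP (tnth t i)).
- move=> /snd_of_f/residually_separated_of_strongly_non_divisible sep H /proper_subgroupP[x xH].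
  have [M [Mfin HM xM]] := sep H x xH; exists M; split=> //.
  by apply/proper_subgroupP; exists x.
- move=> /strongly_non_divisible_of_cofinal/residually_separated_of_strongly_non_divisible sep H.
  exact: residually_finite_of_separated.
Qed.
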